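(* The modal logic $\Gamma(\mathbf{LV},2,1)$ has the uniform Lyndon interpolation property.
   Context: Modal formulas use variables, $\bot,\land,\lor,\neg,\to,\Box$. Positive/negative variables: $v^+(p)=\{p\}$, $v^-(p)=\emptyset$, $v^\circ(\bot)=\emptyset$, $\land,\lor,\Box$ preserve polarity, $v^\pm(\neg\varphi)=v^\mp(\varphi)$, $v^+(\varphi\to\psi)=v^-(\varphi)\cup v^+(\psi)$, $v^-(\varphi\to\psi)=v^+(\varphi)\cup v^-(\psi)$. $\Gamma(\mathbf{LV},2,1)$ is the set of modal formulas true at every world of every Kripke model on the frame $(W,R)$ with $W=\{r,a_0,b_0,a_1,b_1\}$ and $R$ the reflexive transitive closure of $\{(r,a_0),(r,b_0),(r,a_1),(r,b_1),(a_0,b_0),(b_0,a_0),(a_1,b_1),(b_1,a_1)\}$ (a root below two distinct two-element final clusters). A logic $L$ has the uniform Lyndon interpolation property iff for every formula $\varphi$ and finite sets $P^+,P^-$ of variables there is $\theta$ with $L\vdash\varphi\to\theta$, $v^\circ(\theta)\subseteq v^\circ(\varphi)\setminus P^\circ$ for $\circ\in\{+,-\}$, and $L\vdash\theta\to\psi$ for every $\psi$ with $L\vdash\varphi\to\psi$ and $v^\circ(\psi)\cap P^\circ=\emptyset$ for $\circ\in\{+,-\}$. *)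

(* Defs.v *)
From mathcomp Require Import all_boot.

Set Implicit Arguments.
Unset Strict Implicit.
Unset Printing Implicit Defensive.

(* Propositional variables are natural numbers. *)
Inductive form : Type :=
| Var of nat
| Bot
| And of form & form
| Or of form & form
| Neg of form
| Imp of form & form
| Box of form.

Inductive polarity : Type := Pos | Opp.

Definition flip (o : polarity) : polarity :=
  match o with Pos => Opp | Opp => Pos end.

(* [vars Pos phi] is v^+(phi) and [vars Opp phi] is v^-(phi); finite sets of
   variables are sequences, used only through membership. *)
Fixpoint vars (o : polarity) (phi : form) : seq nat :=
  match phi with
  | Var p => match o with Pos => [:: p] | Opp => [::] end
  | Bot => [::]
  | And phi1 phi2 | Or phi1 phi2 => vars o phi1 ++ vars o phi2
  | Neg phi1 => vars (flip o) phi1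
  | Imp phi1 phi2 => vars (flip o) phi1 ++ vars o phi2
  | Box phi1 => vars o phi1
  end.

Fixpoint sat (W : finType) (R : rel W) (V : nat -> pred W) (w : W)
    (phi : form) : bool :=
  match phi with
  | Var p => V p w
  | Bot => false
  | And phi1 phi2 => sat R V w phi1 && sat R V w phi2
  | Or phi1 phi2 => sat R V w phi1 || sat R V w phi2
  | Neg phi1 => ~~ sat R V w phi1
  | Imp phi1 phi2 => sat R V w phi1 ==> sat R V w phi2
  | Box phi1 => [forall u, R w u ==> sat R V u phi1]
  end.

Definition frame_logic (W : finType) (R : rel W) (phi : form) : Prop :=
  forall (V : nat -> pred W) (w : W), sat R V w phi.

(* A logic is given by its set of theorems: [L phi] reads "L proves phi". *)
Definition uniform_lyndon_interpolation (L : form -> Prop) : Prop :=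
  forall (phi : form) (P : polarity -> seq nat),
  exists theta : form,
    [/\ L (Imp phi theta),
        forall o q, q \in vars o theta -> q \in vars o phi /\ q \notin P o
      & forall psi : form,
          L (Imp phi psi) ->
          (forall o q, q \in vars o psi -> q \notin P o) ->
          L (Imp theta psi)].

(* The five worlds: the root is [None]; a_i and b_i are the two points of the
   i-th cluster, i = 0, 1 being encoded as [false], [true]. *)
Definition LV21_world : finType := option (bool * bool).

Definition w_r : LV21_world := None.
Definition w_a0 : LV21_world := Some (false, false).
Definition w_b0 : LV21_world := Some (false, true).
Definition w_a1 : LV21_world := Some (true, false).
Definition w_b1 : LV21_world := Some (true, true).

Definition LV21_base : rel LV21_world := fun u v =>
  (u, v) \in [:: (w_r, w_a0); (w_r, w_b0); (w_r, w_a1); (w_r, w_b1);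
                 (w_a0, w_b0); (w_b0, w_a0); (w_a1, w_b1); (w_b1, w_a1)].

(* [connect] is the reflexive transitive closure. *)
Definition LV21_rel : rel LV21_world := connect LV21_base.

Definition Gamma_LV_2_1 : form -> Prop := frame_logic LV21_rel.

(* Main.v *)
From mathcomp Require Import all_boot.
Require Import Defs.

Set Implicit Arguments.
Unset Strict Implicit.
Unset Printing Implicit Defensive.

(** Collapsing the frame onto one of its clusters shows that truth at the root
    in all models is truth everywhere, so only the root matters.  For a model
    [M] and sets [Q Pos], [Q Opp] of variables, a formula [description Q M]
    says of a model [N] that the root of [M] is below the root of [N], and that
    clusters of [M] and [N], and the points of related clusters, are matched by
    relations total on both sides.  A total and surjective relation between two
    two-element sets contains a bijection, so such a matching comes from an
    automorphism [g] of the frame with [M] below [N \o g] on [Q].  The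
    interpolant of [phi] is the disjunction of the descriptions of the finitely
    many models of [phi]; if [N] satisfies it, a valuation interpolating
    between [M] and [N \o g] satisfies [phi], hence [psi], hence so does [N]. *)

(** * Monotonicity in polarities and invariance under bounded morphisms *)

Section Frames.

Variables (W : finType) (R : rel W).
Implicit Types (V : nat -> pred W) (phi : form).

(** Induction on [phi] with both valuations generalized: negation and the antecedent of an
    implication exchange them together with the polarities. *)
Lemma sat_monotone V1 V2 phi (w : W) :
  (forall q u, q \in vars Pos phi -> V1 q u -> V2 q u) ->
  (forall q u, q \in vars Opp phi -> V2 q u -> V1 q u) ->
  sat R V1 w phi -> sat R V2 w phi.
Proof.
elim: phi V1 V2 w => [p||A IHA B IHB|A IHA B IHB|A IHA|A IHA B IHB|A IHA]
  V1 V2 w //= HP HN.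
- by apply: HP; rewrite inE.
- case/andP=> sA sB; apply/andP.
  split; [move: sA; apply: IHA|move: sB; apply: IHB];
    by move=> q u Hq; first [apply: HP|apply: HN]; rewrite mem_cat Hq ?orbT.
- case/orP=> [sA|sB]; apply/orP.
    left; move: sA; apply: IHA;
      by move=> q u Hq; first [apply: HP|apply: HN]; rewrite mem_cat Hq ?orbT.
  right; move: sB; apply: IHB;
    by move=> q u Hq; first [apply: HP|apply: HN]; rewrite mem_cat Hq ?orbT.
- by apply: contra; apply: IHA.
- move=> /implyP sAB; apply/implyP=> sA.
  have /sAB: sat R V1 w A.
    move: sA; apply: IHA;
      by move=> q u Hq; first [apply: HN|apply: HP]; rewrite mem_cat Hq ?orbT.
  apply: IHB;
    by move=> q u Hq; first [apply: HP|apply: HN]; rewrite mem_cat Hq ?orbT.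
- move/forallP=> sA; apply/forallP=> u; apply/implyP=> wu.
  by move/(_ u): sA; rewrite wu /=; apply: IHA.
Qed.

Lemma sat_bounded_morphism (f : W -> W) V phi (w : W) :
  (forall u v, R u v -> R (f u) (f v)) ->
  (forall u v, R (f u) v -> exists2 u', R u u' & f u' = v) ->
  sat R V (f w) phi = sat R (fun q u => V q (f u)) w phi.
Proof.
move=> forth back; elim: phi w => [p||A IHA B IHB|A IHA B IHB|A IHA|A IHA B IHB|A IHA] w //=;
  rewrite ?IHA ?IHB //.
apply/forallP/forallP=> sA u; apply/implyP.
- by move=> /forth wu; rewrite -IHA; move/(_ (f u)): sA; rewrite wu.
- by case/back=> v wv <-; rewrite IHA; move/(_ v): sA; rewrite wv.
Qed.

End Frames.

(** * Derived connectives and formulas over a signed vocabulary *)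

Definition Top : form := Neg Bot.
Definition Dia (A : form) : form := Neg (Box (Neg A)).

Definition big_and (I : Type) (s : seq I) (F : I -> form) : form :=
  foldr (fun i => And (F i)) Top s.
Definition big_or (I : Type) (s : seq I) (F : I -> form) : form :=
  foldr (fun i => Or (F i)) Bot s.

Lemma flipK : involutive flip.
Proof. by case. Qed.

Section Vocabulary.

Variable Q : polarity -> seq nat.

Definition in_vocabulary (A : form) : Prop :=
  forall o, {subset vars o A <= Q o}.

Lemma in_vocabulary_And A B :
  in_vocabulary A -> in_vocabulary B -> in_vocabulary (And A B).
Proof. by move=> hA hB o q; rewrite mem_cat => /orP[/hA|/hB]. Qed.

Lemma in_vocabulary_Or A B :
  in_vocabulary A -> in_vocabulary B -> in_vocabulary (Or A B).
Proof. by move=> hA hB o q; rewrite mem_cat => /orP[/hA|/hB]. Qed.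

Lemma in_vocabulary_Dia A : in_vocabulary A -> in_vocabulary (Dia A).
Proof. by move=> hA o q; rewrite /Dia /= flipK => /hA. Qed.

Lemma in_vocabulary_big_and (I : eqType) (s : seq I) F :
  {in s, forall i, in_vocabulary (F i)} -> in_vocabulary (big_and s F).
Proof.
elim: s => [_ []|i s IH hF] //=.
apply: in_vocabulary_And; first by apply: hF; rewrite mem_head.
by apply: IH => j js; apply: hF; rewrite inE js orbT.
Qed.

Lemma in_vocabulary_big_or (I : Type) (s : seq I) F :
  (forall i, in_vocabulary (F i)) -> in_vocabulary (big_or s F).
Proof. by move=> hF; elim: s => //= i s IH; apply: in_vocabulary_Or. Qed.

End Vocabulary.

Section DerivedConnectives.

Variables (W : finType) (R : rel W) (V : nat -> pred W).

Lemma sat_Dia w A : sat R V w (Dia A) = [exists u, R w u && sat R V u A].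
Proof.
by rewrite /Dia /= negb_forall; apply: eq_existsb => u; rewrite negb_imply negbK.
Qed.

Lemma sat_big_and w (I : Type) (s : seq I) F :
  sat R V w (big_and s F) = all (fun i => sat R V w (F i)) s.
Proof. by elim: s => //= i s ->. Qed.

Lemma sat_big_or w (I : Type) (s : seq I) F :
  sat R V w (big_or s F) = has (fun i => sat R V w (F i)) s.
Proof. by elim: s => //= i s ->. Qed.

End DerivedConnectives.

(** * The frame, its collapses and its automorphisms *)

Definition LV21_le : rel LV21_world := fun u v =>
  match u, v with
  | None, _ => true
  | Some _, None => false
  | Some (i, _), Some (j, _) => i == j
  end.

Lemma LV21_relE : LV21_rel =2 LV21_le.
Proof.
move=> u v; apply/idP/idP.
- case/connectP=> p; elim: p u => [|x p IH] u /=.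
    by move=> _ ->; case: u => [[i a]|] /=.
  case/andP=> ux /IH xv /xv; move: ux {IH xv}.
  by case: u => [[[] []]|] //; case: x => [[[] []]|] //; case: v => [[[] []]|].
- have [-> _|nuv uv] := eqVneq u v; first exact: connect0.
  apply: connect1; move: nuv uv.
  by case: u => [[[] []]|] //; case: v => [[[] []]|].
Qed.

Lemma frame_logic_at_root A :
  (forall V, sat LV21_rel V w_r A) -> Gamma_LV_2_1 A.
Proof.
move=> rootA V [[i x]|]; last exact: rootA.
(* Collapse onto cluster [i], keeping the position in the cluster and sending the root to the given
   point. The back condition holds because every world sees points in both positions. *)
pose h (u : LV21_world) : LV21_world := Some (i, if u is Some (_, y) then y else x).
rewrite -[Some (i, x)]/(h w_r) sat_bounded_morphism //.
- by move=> u v _; rewrite LV21_relE /h /= eqxx.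
- move=> u [[j y]|]; rewrite LV21_relE //= => /eqP <-.
  case: u => [[k z]|]; first by exists (Some (k, y)); rewrite ?LV21_relE /=.
  by exists (Some (i, y)); rewrite ?LV21_relE.
Qed.

(** The automorphisms of the frame: [s] tells whether the clusters are exchanged, [t i] whether the
    points of the source cluster [i] are. *)
Definition swap_points (s : bool) (t : bool -> bool) (u : LV21_world) :
    LV21_world :=
  if u is Some (i, x) then Some (s (+) i, t i (+) x) else None.

Lemma sat_swap_points s t V A u :
  sat LV21_rel V (swap_points s t u) A
  = sat LV21_rel (fun q v => V q (swap_points s t v)) u A.
Proof.
apply: sat_bounded_morphism.
- move=> [[i x]|] [[j y]|]; rewrite !LV21_relE //= => /eqP->.
  exact: eqxx.
- move=> [[i x]|] [[j y]|]; rewrite !LV21_relE //=.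
  + move/eqP=> <-; exists (Some (i, t i (+) y)); first by rewrite LV21_relE /=.
    by rewrite /= addbA addbb.
  + move=> _; exists (Some (s (+) j, t (s (+) j) (+) y)); first by rewrite LV21_relE.
    by rewrite /= !addbA !addbb.
  + by exists None; rewrite ?LV21_relE.
Qed.

(** If the identity is not contained in [B], a diagonal pair is missing; totality and surjectivity
    at that pair then force both off-diagonal pairs. *)
Lemma bool_matching (B : rel bool) :
  (forall x, exists y, B x y) -> (forall y, exists x, B x y) ->
  exists s, forall x, B x (s (+) x).
Proof.
move=> tot surj.
have [/andP[B0 B1]|nid] := boolP (B false false && B true true).
  by exists false; case.
exists true; move: (tot false) (tot true) (surj false) (surj true).
move=> [[] h1] [[] h2] [[] h3] [[] h4] [] //=; move: nid;
  by rewrite ?h1 ?h2 ?h3 ?h4.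
Qed.

(** * Describing a model up to automorphism *)

Section Description.

Variables (Q : polarity -> seq nat) (M : nat -> pred LV21_world).

Definition below (w : LV21_world) (N : nat -> pred LV21_world)
    (u : LV21_world) : Prop :=
  (forall q, q \in Q Pos -> M q w -> N q u) /\
  (forall q, q \in Q Opp -> N q u -> M q w).

Definition point_type (w : LV21_world) : form :=
  And (big_and [seq q <- Q Pos | M q w] Var)
      (big_and [seq q <- Q Opp | ~~ M q w] (fun q => Neg (Var q))).

(** The cover modality applied to the two point types: the diamonds make the matching of points
    total, the box makes it surjective. *)
Definition cluster_type (i : bool) : form :=
  And (And (Dia (point_type (Some (i, false))))
           (Dia (point_type (Some (i, true)))))
      (Box (Or (point_type (Some (i, false))) (point_type (Some (i, true))))).

(** The prefixes [Dia (Box _)] and [Box (Dia _)] transfer the cluster types to final clusters; the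
    root itself need not satisfy any of them. *)
Definition description : form :=
  And (point_type w_r)
      (And (And (Dia (Box (cluster_type false))) (Dia (Box (cluster_type true))))
           (Box (Dia (Or (cluster_type false) (cluster_type true))))).

Lemma in_vocabulary_description : in_vocabulary Q description.
Proof.
have hp w : in_vocabulary Q (point_type w).
  apply: in_vocabulary_And; apply: in_vocabulary_big_and => q;
    rewrite mem_filter => /andP[_ hq] [] r //=; by rewrite inE => /eqP->.
have hc i : in_vocabulary Q (cluster_type i).
  apply: in_vocabulary_And; first by apply: in_vocabulary_And; apply: in_vocabulary_Dia.
  exact: (in_vocabulary_Or (hp _) (hp _)).
apply: in_vocabulary_And => //; apply: in_vocabulary_And.
  by apply: in_vocabulary_And; apply: in_vocabulary_Dia; apply: hc.
exact: (in_vocabulary_Dia (in_vocabulary_Or (hc _) (hc _))).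
Qed.

Variable N : nat -> pred LV21_world.

Lemma sat_point_typeP w u :
  reflect (below w N u) (sat LV21_rel N u (point_type w)).
Proof.
rewrite /point_type [sat _ _ _ _]/= !sat_big_and; apply: (iffP andP).
- move=> [/allP hP /allP hN]; split=> q hq.
    by move=> Mq; apply: (hP q); rewrite mem_filter Mq.
  by apply: contraLR => Mq; apply: (hN q); rewrite mem_filter Mq.
- move=> [hP hN]; split; apply/allP=> q; rewrite mem_filter => /andP[Mq hq].
    exact: hP Mq.
  by apply: contra Mq; apply: hN.
Qed.

Lemma sat_cluster_typeE i u :
  sat LV21_rel N u (cluster_type i) =
  [&& [exists v, LV21_rel u v && sat LV21_rel N v (point_type (Some (i, false)))],
      [exists v, LV21_rel u v && sat LV21_rel N v (point_type (Some (i, true)))]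
    & [forall v, LV21_rel u v ==>
        (sat LV21_rel N v (point_type (Some (i, false)))
         || sat LV21_rel N v (point_type (Some (i, true))))]].
Proof. by rewrite -!sat_Dia andbA. Qed.

Lemma sat_descriptionE :
  sat LV21_rel N w_r description =
  [&& sat LV21_rel N w_r (point_type w_r),
      [exists u, LV21_rel w_r u && sat LV21_rel N u (Box (cluster_type false))],
      [exists u, LV21_rel w_r u && sat LV21_rel N u (Box (cluster_type true))]
    & [forall u, LV21_rel w_r u ==>
        sat LV21_rel N u (Dia (Or (cluster_type false) (cluster_type true)))]].
Proof. by rewrite -!sat_Dia [X in _ && X]andbA. Qed.

Lemma sat_cluster_type_matching i j y :
  sat LV21_rel N (Some (j, y)) (cluster_type i) ->
  exists s, forall x, below (Some (i, x)) N (Some (j, s (+) x)).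
Proof.
rewrite sat_cluster_typeE => /and3P[/existsP[u0 /andP[ju0 h0]]].
move=> /existsP[u1 /andP[ju1 h1]] /forallP hall.
have [] := @bool_matching (fun x z =>
    sat LV21_rel N (Some (j, z)) (point_type (Some (i, x)))).
- have ex_in_cluster v A : LV21_rel (Some (j, y)) v -> sat LV21_rel N v A ->
      exists z, sat LV21_rel N (Some (j, z)) A.
    by case: v => [[k z]|]; rewrite LV21_relE //= => /eqP <-; exists z.
  by move=> [|]; [apply: ex_in_cluster h1|apply: ex_in_cluster h0].
- move=> z; move/(_ (Some (j, z))): hall; rewrite LV21_relE /= eqxx /=.
  by case/orP=> h; [exists false|exists true].
- by move=> s hs; exists s => x; apply/sat_point_typeP.
Qed.

Lemma sat_cluster_type_below i y :
  (forall w, below w N w) -> sat LV21_rel N (Some (i, y)) (cluster_type i).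
Proof.
move=> hle; rewrite sat_cluster_typeE; apply/and3P; split.
- by apply/existsP; exists (Some (i, false)); rewrite LV21_relE /= eqxx; apply/sat_point_typeP.
- by apply/existsP; exists (Some (i, true)); rewrite LV21_relE /= eqxx; apply/sat_point_typeP.
- apply/forallP=> -[[j z]|]; rewrite LV21_relE //=; apply/implyP=> /eqP <-.
  by case: z; apply/orP; [right|left]; apply/sat_point_typeP.
Qed.

Lemma sat_description_below :
  (forall w, below w N w) -> sat LV21_rel N w_r description.
Proof.
move=> hle; rewrite sat_descriptionE.
have hbox i : [exists u, LV21_rel w_r u && sat LV21_rel N u (Box (cluster_type i))].
  apply/existsP; exists (Some (i, false)); rewrite LV21_relE /=.
  apply/forallP=> -[[j z]|]; rewrite LV21_relE //=; apply/implyP=> /eqP <-.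
  exact: sat_cluster_type_below.
rewrite !hbox; apply/andP; split; first exact/sat_point_typeP.
apply/forallP=> u; apply/implyP=> _; rewrite sat_Dia; apply/existsP.
have [i ui] : exists i, LV21_rel u (Some (i, false)).
  by case: u => [[i z]|]; [exists i|exists false]; rewrite LV21_relE /=.
exists (Some (i, false)); rewrite ui; apply/orP.
by case: i {ui}; [right|left]; apply: sat_cluster_type_below.
Qed.

Lemma sat_description_swap :
  sat LV21_rel N w_r description ->
  exists s t, forall w, below w N (swap_points s t w).
Proof.
rewrite sat_descriptionE => /and4P[/sat_point_typeP hr h0 h1 /forallP hall].
pose B i j := [exists y, sat LV21_rel N (Some (j, y)) (cluster_type i)].
have [] := @bool_matching B.
- move=> i.
  have /existsP[u /andP[_ /= /forallP hu]] :
      [exists u, LV21_rel w_r u && sat LV21_rel N u (Box (cluster_type i))].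
    by case: i.
  case: u hu => [[j z]|] hu.
    by exists j; apply/existsP; exists z; move/(_ (Some (j, z))): hu; rewrite LV21_relE /= eqxx.
  (* If the witness is the root, its box reaches both clusters, so either one will do. *)
  by exists false; apply/existsP; exists false; move/(_ (Some (false, false))): hu; rewrite LV21_relE.
- move=> j; move/(_ (Some (j, false))): hall; rewrite LV21_relE sat_Dia /=.
  case/existsP=> -[[k z]|]; rewrite LV21_relE //= => /andP[/eqP <-].
  by case/orP=> h; [exists false|exists true]; apply/existsP; exists z.
(* [s] matches the clusters; within each matched pair, a second matching gives the bijection of
   points. *)
move=> s hs.
have [y0 /sat_cluster_type_matching[t0 ht0]] := existsP (hs false).
have [y1 /sat_cluster_type_matching[t1 ht1]] := existsP (hs true).
exists s, (fun i => if i then t1 else t0) => -[[[] x]|] //=.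
Qed.

End Description.

(** * The uniform interpolant *)

Theorem theorem7p2 : uniform_lyndon_interpolation Gamma_LV_2_1.
Proof.
move=> phi P.
pose Q o := [seq q <- vars o phi | q \notin P o].
pose vs := vars Pos phi ++ vars Opp phi.
(* Only the variables of [phi] matter, so finite functions code all relevant models; other variables
   are false by default. *)
pose model (f : {ffun seq_sub vs * LV21_world -> bool}) q w :=
  if insub q is Some i then f (i, w) else false.
pose models := [seq f <- enum {: {ffun seq_sub vs * LV21_world -> bool}} |
                 sat LV21_rel (model f) w_r phi].
exists (big_or models (fun f => description Q (model f))); split.
- apply: frame_logic_at_root => V /=; apply/implyP=> Vphi.
  pose f := [ffun iw : seq_sub vs * LV21_world => V (val iw.1) iw.2].
  have fE q w : q \in vs -> model f q w = V q w.
    by move=> hq; rewrite /model insubT /= ffunE.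
  have fP q w : q \in vars Pos phi -> model f q w = V q w.
    by move=> hq; apply: fE; rewrite mem_cat hq.
  have fN q w : q \in vars Opp phi -> model f q w = V q w.
    by move=> hq; apply: fE; rewrite mem_cat hq orbT.
  rewrite sat_big_or; apply/hasP; exists f.
    rewrite mem_filter mem_enum andbT.
    by apply: sat_monotone Vphi => q u hq; [rewrite fP|rewrite fN].
  apply: sat_description_below => w.
  by split=> q; rewrite mem_filter => /andP[_ hq]; [rewrite fP|rewrite fN].
- move=> o q; have /(_ o q) h := @in_vocabulary_big_or Q _ models _
      (fun f => @in_vocabulary_description Q (model f)).
  by move/h; rewrite mem_filter => /andP[].
move=> psi phipsi psiP; apply: frame_logic_at_root => N /=; apply/implyP.
rewrite sat_big_or => /hasP[f]; rewrite mem_filter => /andP[Mphi _].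
move: (model f) Mphi => M Mphi /sat_description_swap[s [t hg]].
set g := swap_points s t in hg.
have QP o q : q \in vars o phi -> q \in vars o psi -> q \in Q o.
  by move=> hphi hpsi; rewrite mem_filter hphi (psiP o).
(* The least valuation above [M] on the positive variables of [phi] and above [N \o g] on the
   negative variables of [psi]. The upper bounds needed, [M] on negative variables of [phi] and
   [N \o g] on positive ones of [psi], follow from [hg], as shared variables of equal polarity lie
   in [Q]. *)
pose K q w := (q \in vars Pos phi) && M q w || (q \in vars Opp psi) && N q (g w).
have Kphi : sat LV21_rel K w_r phi.
  apply: sat_monotone Mphi => q w hq; rewrite /K; first by rewrite hq => ->.
  case/orP=> /andP[] // hpsi; apply: (hg w).2; exact: QP.
have Kpsi : sat LV21_rel K w_r psi by move: (phipsi K w_r) => /=; rewrite Kphi.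
(* [g] fixes the root, so [psi] may be evaluated there under [N \o g] instead of [N]. *)
rewrite -[w_r]/(g w_r) sat_swap_points.
apply: sat_monotone Kpsi => q w hq; rewrite /K; last by rewrite hq => ->; rewrite orbT.
case/orP=> /andP[] // hphi; apply: (hg w).1; exact: QP.
Qed.
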